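(* Let $k$ be a positive integer and $\alpha_0,\alpha_1,\dots,\alpha_{k-1}\in\omega_1\setminus\{0\}$. Then \[P^{top}(\omega^{\alpha_0}+1,\omega^{\alpha_1}+1,\dots,\omega^{\alpha_{k-1}}+1)=\omega^{\alpha_0\#\alpha_1\#\cdots\#\alpha_{k-1}}+1.\]
   Context: Ordinals carry the order topology, subsets the subspace topology; arithmetic is ordinal arithmetic. $P^{top}(\alpha_0,\dots,\alpha_{k-1})$ is the least ordinal $\beta$ such that for every $c:\beta\to\{0,\dots,k-1\}$ there exist $i$ and $X\subseteq c^{-1}(\{i\})$ homeomorphic to $\alpha_i$. The natural sum $\alpha\#\beta$: write $\alpha=\sum_j\omega^{\gamma_j}l_j$, $\beta=\sum_j\omega^{\gamma_j}m_j$ with common decreasing exponents $\gamma_1>\dots>\gamma_n$ and $l_j,m_j\in\omega$; then $\alpha\#\beta=\sum_j\omega^{\gamma_j}(l_j+m_j)$ (commutative and associative). *)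

(* Defs.v *)
From HB Require Import structures.
From mathcomp Require Import all_boot all_order.
From mathcomp Require Import all_classical topology.

Set Implicit Arguments.
Unset Strict Implicit.
Unset Printing Implicit Defensive.

Import Order.TTheory.
Local Open Scope classical_set_scope.
Local Open Scope order_scope.
Local Open Scope quotient_scope.

(* Ordinals are well-founded trees up to equality of heights, the height of
   [otnode f] being the least ordinal above the heights of all the [f a].
   Every well-order on a type in the universe of [A] has its order type here. *)
Inductive otree : Type := otnode (A : Type) (f : A -> otree).

Fixpoint ot_le (s t : otree) : Prop :=
  match s, t with
  | otnode A f, otnode B g => forall a, exists b, ot_le (f a) (g b)
  end.

Definition ot_lt (s t : otree) : Prop :=
  let: otnode B g := t in exists b, ot_le s (g b).

Lemma ot_le_refl s : ot_le s s.
Proof. by elim: s => A f IH /= a; exists a. Qed.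

Lemma ot_le_trans t s u : ot_le s t -> ot_le t u -> ot_le s u.
Proof.
elim: s t u => A f IH [B g] [C h] /= st tu a.
by have [b fg] := st a; have [c gh] := tu b; exists c; exact: IH gh.
Qed.

Lemma ot_lt_total s t : ot_le t s \/ ot_lt s t.
Proof.
elim: s t => A f IH [B g].
have [ts|] := pselect (forall b, exists a, ot_le (g b) (f a)); first by left.
move=> /existsNP[b] /forallNP gf; right; exists b.
have fg a : ot_lt (f a) (g b) by have [/gf//|] := IH a (g b).
by case: (g b) fg.
Qed.

Lemma ot_lt_irr s : ~ ot_lt s s.
Proof.
elim: s => A f IH [a] /= sfa; apply: (IH a).
case E: (f a) sfa => [B g] /(_ a)[b]; rewrite E => gb.
by exists b.
Qed.

Lemma ot_le_lt_trans s t u : ot_le s t -> ot_lt t u -> ot_lt s u.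
Proof. by case: u => C h st [c tc]; exists c; exact: ot_le_trans st tc. Qed.

Lemma ot_ltNle s t : ot_lt s t <-> ~ ot_le t s.
Proof.
split=> [st ts|]; last by have [//|] := ot_lt_total s t.
exact: ot_lt_irr (ot_le_lt_trans ts st).
Qed.

Lemma ot_ltW s t : ot_lt s t -> ot_le s t.
Proof.
suff child u : let: otnode C h := u in forall c, ot_le (h c) (otnode h).
  by case: t (child t) => A f ft [a sa]; exact: ot_le_trans sa (ft a).
elim: u => C h IH c; move: (IH c); case E: (h c) => [B g] gh /= b.
by exists c; rewrite E.
Qed.

Definition ot_eqv : rel {classic otree} :=
  fun s t => `[< ot_le s t /\ ot_le t s >].

Lemma ot_eqv_refl : reflexive ot_eqv.
Proof. by move=> s; apply/asboolP; split; exact: ot_le_refl. Qed.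

Lemma ot_eqv_sym : symmetric ot_eqv.
Proof. by move=> s t; apply: asbool_equiv_eq; split=> -[]. Qed.

Lemma ot_eqv_trans : transitive ot_eqv.
Proof.
move=> t s u /asboolP[st ts] /asboolP[tu ut]; apply/asboolP.
by split; [exact: ot_le_trans tu|exact: ot_le_trans ts].
Qed.

Canonical ot_equiv := EquivRel ot_eqv ot_eqv_refl ot_eqv_sym ot_eqv_trans.

Definition Ord := {eq_quot ot_eqv}.
HB.instance Definition _ := Choice.on Ord.

Definition Ord_tree (x : Ord) : otree := repr x.
Definition tree_Ord (t : otree) : Ord := \pi_({eq_quot ot_eqv}) t.

Definition Ord_le (x y : Ord) := `[< ot_le (Ord_tree x) (Ord_tree y) >].

Lemma Ord_le_anti : antisymmetric Ord_le.
Proof.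
move=> x y /andP[/asboolP xy /asboolP yx].
rewrite -[x]reprK -[y]reprK; apply/eqP; rewrite piE /=.
exact/asboolP.
Qed.

Lemma Ord_le_trans : transitive Ord_le.
Proof.
by move=> y x z /asboolP xy /asboolP yz; apply/asboolP/(ot_le_trans xy).
Qed.

Lemma Ord_le_total : total Ord_le.
Proof.
move=> x y; apply/orP; have [] := ot_lt_total (Ord_tree x) (Ord_tree y).
  by right; apply/asboolP.
by move=> /ot_ltW; left; apply/asboolP.
Qed.

HB.instance Definition _ := Order.isOrder.Build Order.default_display Ord
  (fun _ _ => erefl) (fun _ _ => erefl) (fun _ _ => erefl)
  Ord_le_anti Ord_le_trans Ord_le_total.

Lemma OrdK : cancel Ord_tree tree_Ord.
Proof. exact: reprK. Qed.

Lemma tree_Ord_le s t : (tree_Ord s <= tree_Ord t) = `[< ot_le s t >].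
Proof.
have K u : ot_le u (Ord_tree (tree_Ord u)) /\ ot_le (Ord_tree (tree_Ord u)) u.
  by apply/asboolP; rewrite -/(ot_eqv _ _) -eqmodE /=; apply/eqP; rewrite reprK.
apply: asbool_equiv_eq; split=> st.
  exact: ot_le_trans (K s).1 (ot_le_trans st (K t).2).
exact: ot_le_trans (K s).2 (ot_le_trans st (K t).1).
Qed.

Lemma tree_Ord_lt s t : (tree_Ord s < tree_Ord t) = `[< ot_lt s t >].
Proof.
by rewrite ltNge tree_Ord_le -asbool_neg; apply/esym/asbool_equiv_eq/ot_ltNle.
Qed.

Lemma Ord_wf : well_founded (fun x y : Ord => x < y).
Proof.
move=> x; rewrite -[x]OrdK; elim: (Ord_tree x) => A f IH; split=> y.
rewrite -[y]OrdK tree_Ord_lt => /asboolP[a ya].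
split=> z zy; apply: (Acc_inv (IH a)).
by apply: lt_le_trans zy _; rewrite tree_Ord_le; apply/asboolP; exact: ya.
Qed.

(* the least ordinal above all the [F a] *)
Definition lsub (A : Type) (F : A -> Ord) : Ord :=
  tree_Ord (otnode (Ord_tree \o F)).

Lemma lt_lsubP A (F : A -> Ord) x : x < lsub F <-> exists a, x <= F a.
Proof.
rewrite -[x]OrdK tree_Ord_lt /=; split=> [/asboolP[a]|[a xa]].
  by move=> xa; exists a; rewrite -[F a]OrdK tree_Ord_le; apply/asboolP.
apply/asboolP; exists a; apply/asboolP.
by rewrite -tree_Ord_le /= (OrdK (F a)).
Qed.

Lemma lsub_leP A (F : A -> Ord) x : lsub F <= x <-> forall a, F a < x.
Proof.
split=> [Fx a|Fx]; first by apply: lt_le_trans Fx; apply/lt_lsubP; exists a.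
by rewrite leNgt; apply/negP => /lt_lsubP[a]; rewrite leNgt Fx.
Qed.

Definition ozero : Ord := lsub (fun v : void => match v with end).
Definition osucc (x : Ord) : Ord := lsub (fun _ : unit => x).
Definition ord_of_nat (n : nat) : Ord := iter n osucc ozero.

Lemma ozero_le x : ozero <= x.
Proof. by apply/lsub_leP => -[]. Qed.

Lemma lt_osucc x y : (x < osucc y) = (x <= y).
Proof. by apply/idP/idP => [/lt_lsubP[]//|xy]; apply/lt_lsubP; exists tt. Qed.

Lemma osucc_le x y : (osucc x <= y) = (x < y).
Proof. by rewrite leNgt lt_osucc -ltNge. Qed.

Lemma osucc_inj : injective osucc.
Proof.
move=> x y E; apply: le_anti.
by rewrite -(lt_osucc x y) -E lt_osucc lexx /= -lt_osucc E lt_osucc.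
Qed.

(* the least element of [A] when [A] is nonempty, and 0 otherwise *)
Definition least (A : set Ord) : Ord := xget ozero (A `&` lbound A).

Lemma leastP (A : set Ord) : A !=set0 -> A (least A) /\ lbound A (least A).
Proof.
move=> [x Ax]; rewrite /least; case: xgetP => // noleast; exfalso.
elim/(well_founded_ind Ord_wf): x Ax => x IH Ax.
apply: (noleast x); split=> // y Ay; rewrite leNgt; apply/negP => yx.
exact: IH Ay.
Qed.

(* the ordinals below [b] *)
Definition oseg (b : Ord) : Type := {x : Ord | x < b}.
HB.instance Definition _ b := SubChoice.on (oseg b).
HB.instance Definition _ b :=
  [SubChoice_isSubOrder of oseg b by <: with Order.default_display].

Lemma oseg_small b :
  exists (A : Type) (F : A -> Ord), range F = [set x | x < b].
Proof.
elim/(well_founded_ind Ord_wf): b => b; rewrite -[b]OrdK.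
case: (Ord_tree b) => A f IH.
have fb a : tree_Ord (f a) < tree_Ord (otnode f).
  by rewrite tree_Ord_lt; apply/asboolP; exists a; exact: ot_le_refl.
pose C a := projT1 (cid (IH _ (fb a))).
pose F a : C a -> Ord := projT1 (cid (projT2 (cid (IH _ (fb a))))).
have FP a : range (F a) = [set x | x < tree_Ord (f a)].
  exact: projT2 (cid (projT2 (cid (IH _ (fb a))))).
exists {a : A & option (C a)}.
exists (fun p => if projT2 p is Some c then F _ c else tree_Ord (f (projT1 p))).
apply/seteqP; split=> [_ [[a [c|]] _ <-]|x] //=.
  apply: lt_trans (fb a); have : range (F a) (F a c) by exists c.
  by rewrite FP.
rewrite -[x]OrdK tree_Ord_lt => /asboolP[a xa].
have : tree_Ord (Ord_tree x) <= tree_Ord (f a).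
  by rewrite tree_Ord_le; apply/asboolP.
rewrite le_eqVlt => /orP[/eqP ->|xa']; first by exists (existT _ a None).
have [c _ <-] : range (F a) (tree_Ord (Ord_tree x)) by rewrite FP.
by exists (existT _ a (Some c)).
Qed.

Lemma oseg_bounded b (F : oseg b -> Ord) : has_ubound (range F).
Proof.
have [A [G GE]] := oseg_small b.
have Gb a : G a < b.
  have : range G (G a) by exists a.
  by rewrite GE.
exists (lsub (fun a => F (exist _ (G a) (Gb a)))) => _ [[x xb] _ <-].
have [a _ Ga] : range G x by rewrite GE.
apply/ltW/lt_lsubP; exists a.
suff -> : exist _ x xb = exist _ (G a) (Gb a) :> oseg b by [].
exact/val_inj/esym.
Qed.

Lemma has_ubound_supremums (A : set Ord) : has_ubound A -> supremums A !=set0.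
Proof. by move=> /leastP[]; exists (least (ubound A)). Qed.

Definition is_limit (h : Ord) : Prop :=
  h <> ozero /\ forall g, osucc g <> h.

Definition trec_step (z : Ord) (s : Ord -> Ord) (b : Ord)
    (rec : forall g, g < b -> Ord) : Ord :=
  if b == ozero then z
  else match pselect (exists g : oseg b, osucc (val g) = b) with
  | left bS => s (rec _ (valP (projT1 (cid bS))))
  | right _ => supremum ozero (range (fun g : oseg b => rec _ (valP g)))
  end.

(* transfinite recursion: [z] at 0, [s] at successor steps, suprema at limits *)
Definition trec (z : Ord) (s : Ord -> Ord) : Ord -> Ord :=
  Fix Ord_wf (fun=> Ord) (trec_step z s).

Lemma trecE z s b :
  trec z s b = trec_step z s (fun g (_ : g < b) => trec z s g).
Proof.
rewrite /trec Fix_eq // => x f g fg; congr trec_step.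
by apply: functional_extensionality_dep => y; apply/funext => yx; exact: fg.
Qed.

Lemma trec0 z s : trec z s ozero = z.
Proof. by rewrite trecE /trec_step eqxx. Qed.

Lemma trecS z s g : trec z s (osucc g) = s (trec z s g).
Proof.
have gS : g < osucc g by rewrite lt_osucc.
rewrite trecE /trec_step gt_eqF ?(le_lt_trans (ozero_le g))//.
case: pselect => [gE|[]]; last by exists (exist _ g gS).
by case: cid => /= h /osucc_inj ->.
Qed.

Lemma trec_limit z s h : is_limit h ->
  trec z s h = supremum ozero [set trec z s g | g in [set g | g < h]].
Proof.
move=> [/eqP h0 hS]; rewrite trecE /trec_step (negbTE h0).
case: pselect => [[g /hS]//|_]; congr supremum.
apply/seteqP; split=> [_ [g _ <-]|_ [g gh <-]].
  by exists (val g) => //; exact: (valP g).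
by exists (exist _ g gh).
Qed.

Definition oadd (x : Ord) : Ord -> Ord := trec x osucc.
Definition omul (x : Ord) : Ord -> Ord := trec ozero (oadd^~ x).
Definition oexp (x : Ord) : Ord -> Ord := trec (osucc ozero) (omul^~ x).

Definition oomega : Ord := lsub ord_of_nat.

Declare Scope ord_scope.
Delimit Scope ord_scope with ord.
Notation "0" := ozero : ord_scope.
Notation "1" := (osucc ozero) : ord_scope.
Notation "x + y" := (oadd x y) : ord_scope.
Notation "x * y" := (omul x y) : ord_scope.
Notation "x ^ y" := (oexp x y) : ord_scope.
Local Open Scope ord_scope.

Lemma oadd1 x : x + 1 = osucc x.
Proof. by rewrite /oadd trecS trec0. Qed.

(* the least uncountable ordinal *)
Definition oomega1 : Ord := least [set x | ~ countable [set y | y < x]].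

(* all countable ordinals are obtained by [lsub] over [nat], starting from 0 *)
Inductive ctree : Set := ctzero | ctnode (f : nat -> ctree).

Fixpoint ctree_Ord (t : ctree) : Ord :=
  if t is ctnode f then lsub (fun n => ctree_Ord (f n)) else ozero.

Lemma countable_ctree x : countable [set y | y < x] ->
  exists t, x = ctree_Ord t.
Proof.
elim/(well_founded_ind Ord_wf): x => x IH cx.
have /pfcard_geP[x0|[e]] := cx.
  exists ctzero; apply: le_anti; rewrite ozero_le andbT leNgt.
  by apply/negP => /= lt0; have : [set y | y < x] ozero by []; rewrite x0.
have ex n : e n < x by exact: (@funS _ _ _ _ e n I).
have en n : exists t, e n = ctree_Ord t.
  apply: IH => //; apply: sub_countable cx; apply: subset_card_le => y /= yn.
  exact: lt_trans (ex n).
have [T TE] := choice en; exists (ctnode T); apply: le_anti => /=.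
apply/andP; split; last by apply/lsub_leP => n; rewrite -TE.
rewrite leNgt; apply/negP => ltx.
have [n _ nE] := @surj _ _ _ _ e _ ltx.
have : ctree_Ord (T n) < lsub (fun n => ctree_Ord (T n)).
  by apply/lt_lsubP; exists n.
by rewrite -TE nE ltxx.
Qed.

Lemma lt_oomega1 x : (x < oomega1) <-> countable [set y | y < x].
Proof.
have [unc lb] : ~ countable [set y | y < oomega1] /\
    forall y, ~ countable [set z | z < y] -> oomega1 <= y.
  apply: (leastP (A := [set x | ~ countable [set y | y < x]])).
  exists (lsub ctree_Ord) => /countable_ctree[t tE].
  have : ctree_Ord t < lsub ctree_Ord by apply/lt_lsubP; exists t.
  by rewrite tE ltxx.
split=> [xo|cx]; first by apply: contrapT => /lb; rewrite leNgt xo.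
rewrite ltNge; apply/negP => ox; apply: unc.
apply: sub_countable cx; apply: subset_card_le => y /= /lt_le_trans; exact.
Qed.

(* a sum in the order of increasing [j]; coefficients may vanish *)
Definition cnf (n : nat) (g : 'I_n -> Ord) (l : 'I_n -> nat) : Ord :=
  \big[oadd/0]_(j < n) (oomega ^ g j * ord_of_nat (l j)).

Definition natsum_spec (a b c : Ord) : Prop :=
  exists (n : nat) (g : 'I_n -> Ord) (l m : 'I_n -> nat),
    [/\ forall i j : 'I_n, (i < j)%N -> g j < g i,
        a = cnf g l, b = cnf g m & c = cnf g (fun j => (l j + m j)%N)].

(* the Hessenberg sum: [c] in [natsum_spec a b c] is determined by [a] and [b] *)
Definition natsum (a b : Ord) : Ord := xget 0 (natsum_spec a b).

(* [b], seen as the space of the ordinals below [b] with the order topology *)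
Definition ordspace (b : Ord) : Type := order_topology (oseg b).
HB.instance Definition _ b := OrderTopological.on (ordspace b).

Definition homeomorphic (S T : topologicalType) : Prop :=
  exists (f : S -> T) (g : T -> S),
    [/\ cancel f g, cancel g f, continuous f & continuous g].

Definition top_arrow (k : nat) (b : Ord) (alpha : 'I_k -> Ord) : Prop :=
  forall c : ordspace b -> 'I_k,
  exists (i : 'I_k) (X : set (ordspace b)),
    X `<=` c @^-1` [set i] /\ homeomorphic (set_type X) (ordspace (alpha i)).

Definition Ptop (k : nat) (alpha : 'I_k -> Ord) : Ord :=
  least [set b | top_arrow b alpha].

(* Main.v *)
(* Count with Cantor-Bendixson ranks.  Colour an ordinal and let [r_i] be the rank
   of [x] in the subspace formed by [x] and the points of colour [i]; the rank of
   [x] in the whole space is then at most the natural sum of the [r_i].  Applied to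
   the point [omega ^ g] of rank [g = alpha_0 # ... # alpha_(k-1)], this gives a
   point of rank at least [alpha_i] inside its own colour [i], and a countable set
   with such a point contains a copy of [omega ^ alpha_i + 1].
   Conversely, reading off Cantor normal forms splits [g] into [k] pieces of order
   types [alpha_i].  Colour the points below [omega ^ g] by the piece containing
   their rank: within colour [i] the rank of a point is at most the position of its
   original rank in the piece, hence less than [alpha_i], whereas
   [omega ^ alpha_i + 1] has a point of rank [alpha_i]. *)
From HB Require Import structures.
Require Import Defs.
From mathcomp Require Import all_boot all_order.
From mathcomp Require Import interval all_classical topology.

Set Implicit Arguments.
Unset Strict Implicit.
Unset Printing Implicit Defensive.

Import Order.TTheory.
Local Open Scope classical_set_scope.
Local Open Scope order_scope.
Local Open Scope ord_scope.

(** * Ordinal arithmetic *)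

Lemma lt_ord_ind (P : Ord -> Prop) :
  (forall x, (forall y, y < x -> P y) -> P x) -> forall x, P x.
Proof. exact: (well_founded_ind Ord_wf). Qed.

Lemma lt0o x : (0 < x) = (x != 0).
Proof. by rewrite lt_neqAle ozero_le andbT eq_sym. Qed.

Lemma leo0 x : (x <= 0) = (x == 0).
Proof. by rewrite le_eqVlt ltNge ozero_le orbF. Qed.

Lemma osucc_lt x : x < osucc x.
Proof. by rewrite lt_osucc. Qed.

Lemma lt_osucc2 x y : (osucc x < osucc y) = (x < y).
Proof. by rewrite lt_osucc osucc_le. Qed.

Variant ord_spec (x : Ord) : Prop :=
| OrdZero of x = 0
| OrdSucc y of x = osucc y
| OrdLimit of is_limit x.

Lemma ordP x : ord_spec x.
Proof.
have [->|/eqP x0] := eqVneq x 0; first exact: OrdZero.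
have [[y yx]|nx] := pselect (exists y, osucc y = x).
  exact: OrdSucc (esym yx).
by apply: OrdLimit; split=> // g gx; apply: nx; exists g.
Qed.

Lemma limit_lt h g : is_limit h -> g < h -> osucc g < h.
Proof. by move=> [_ hS] gh; rewrite lt_neqAle osucc_le gh andbT; apply/eqP/hS. Qed.

Lemma limit_gt0 h : is_limit h -> 0 < h.
Proof. by move=> [/eqP h0 _]; rewrite lt0o. Qed.

(** [supremum] is picked by choice, so boundedness must first provide a supremum; for empty [B] the
    default 0 is the right value. *)
Lemma lt_supremumP (B : set Ord) (w : Ord) : has_ubound B ->
  w < supremum 0 B <-> exists2 y, B y & w < y.
Proof.
move=> Bub; have /has_ubound_supremums Bs := Bub.
have [->|B0] := eqVneq B set0.
  by rewrite supremum0; split=> [|[]//]; rewrite ltNge ozero_le.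
have [ub lb] : supremums B (supremum 0 B).
  by rewrite /supremum (negbTE B0); case: xgetP => // nB; case: Bs => x /nB.
split=> [wB|[y By wy]]; last by apply: lt_le_trans wy _; exact: ub.
apply: contrapT => nw; move: wB; rewrite ltNge => /negP; apply; apply: lb.
by move=> y By; rewrite leNgt; apply/negP => wy; apply: nw; exists y.
Qed.

Lemma lt_trec_limit z s h w : is_limit h ->
  w < trec z s h <-> exists2 g, g < h & w < trec z s g.
Proof.
move=> hl; rewrite trec_limit// lt_supremumP; last first.
  have [u uP] := oseg_bounded (fun p : oseg h => trec z s (val p)).
  exists u => _ [g gh <-]; apply: uP.
  by exists (exist _ g gh).
by split=> [[_ [g gh <-] wg]|[g gh wg]]; [exists g|exists (trec z s g) => //; exists g].
Qed.

Lemma oadd0 x : x + 0 = x. Proof. exact: trec0. Qed.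
Lemma oaddS x y : x + osucc y = osucc (x + y). Proof. exact: trecS. Qed.
Lemma omul0 x : x * 0 = 0. Proof. exact: trec0. Qed.
Lemma omulS x y : x * osucc y = x * y + x. Proof. exact: trecS. Qed.
Lemma oexp0 x : x ^ 0 = 1. Proof. exact: trec0. Qed.
Lemma oexpS x y : x ^ osucc y = x ^ y * x. Proof. exact: trecS. Qed.

(** With the initial segment below a sum described in one formula, later facts on addition avoid the
    distinction between successors and limits. *)
Lemma lt_oaddP x y w : w < x + y <-> w < x \/ exists2 v, v < y & w <= x + v.
Proof.
elim/lt_ord_ind: y w => y IH w; case: (ordP y) => [->|z yz|yl].
- rewrite oadd0; split=> [|[//|[v]]]; first by left.
  by rewrite ltNge ozero_le.
- rewrite yz oaddS lt_osucc; split=> [wz|].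
    by right; exists z => //; exact: osucc_lt.
  move=> [wx|[v]].
    have [->|z0] := eqVneq z 0; first by rewrite oadd0 ltW.
    apply/ltW; apply/IH; first by rewrite yz osucc_lt.
    by left.
  rewrite lt_osucc le_eqVlt => /predU1P[->//|vz] wv.
  apply: le_trans wv _; apply/ltW/IH; first by rewrite yz osucc_lt.
  by right; exists v.
- split=> [|[wx|[v vy wv]]].
  + rewrite {1}/oadd lt_trec_limit// => -[g gy].
    rewrite -/(oadd x g) => /IH -/(_ gy)[|[v vg wv]]; first by left.
    by right; exists v => //; exact: lt_trans gy.
  + rewrite {1}/oadd lt_trec_limit//; exists 0; first exact: limit_gt0.
    by rewrite trec0.
  + rewrite {1}/oadd lt_trec_limit//; exists (osucc v); first exact: limit_lt.
    by rewrite -/(oadd x _) oaddS lt_osucc.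
Qed.

Lemma le_oaddr x y : x <= x + y.
Proof.
rewrite leNgt; apply/negP => lt.
by have : x + y < x + y; [apply/lt_oaddP; left|rewrite ltxx].
Qed.

Lemma lt_oadd2l x v y : (x + v < x + y) = (v < y).
Proof.
have lt a b : a < b -> x + a < x + b by move=> ab; apply/lt_oaddP; right; exists a.
apply/idP/idP; last exact: lt.
by apply: contraTT; rewrite -!leNgt le_eqVlt => /predU1P[->//|/lt/ltW].
Qed.

Lemma le_oadd2l x v y : (x + v <= x + y) = (v <= y).
Proof. by rewrite !leNgt lt_oadd2l. Qed.

Lemma oadd_inj x : injective (oadd x).
Proof. by move=> u v E; apply: le_anti; rewrite -(le_oadd2l x u) -(le_oadd2l x v) E lexx. Qed.

Lemma lt_oaddr x y : (x < x + y) = (0 < y).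
Proof. by rewrite -{1}[x]oadd0 lt_oadd2l. Qed.

Lemma le_oadd2r y x x' : x <= x' -> x + y <= x' + y.
Proof.
move=> xx'; elim/lt_ord_ind: y => y IH; rewrite leNgt; apply/negP.
move=> /lt_oaddP[|[v vy]]; first by rewrite ltNge (le_trans xx' (le_oaddr _ _)).
by rewrite leNgt (le_lt_trans (IH _ vy))// lt_oadd2l.
Qed.

Lemma ord_ext (x y : Ord) : (forall w, w < x <-> w < y) -> x = y.
Proof.
move=> E; apply: le_anti; apply/andP; split; rewrite leNgt; apply/negP.
  by move=> /E; rewrite ltxx.
by move=> /E; rewrite ltxx.
Qed.

Lemma add0o x : 0 + x = x.
Proof.
elim/lt_ord_ind: x => x IH; apply: ord_ext => w; split.
  move=> /lt_oaddP[|[v vx]]; first by rewrite ltNge ozero_le.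
  by rewrite IH// => /le_lt_trans; exact.
by move=> wx; apply/lt_oaddP; right; exists w; rewrite ?IH.
Qed.

Lemma oaddA : associative oadd.
Proof.
move=> x y z; elim/lt_ord_ind: z => z IH; apply: ord_ext => w; split.
  move=> /lt_oaddP[wx|[v /lt_oaddP[vy|[u uz vu]] wv]].
  - by apply: lt_le_trans (le_oaddr _ _); apply: lt_le_trans (le_oaddr _ _).
  - apply: lt_le_trans (le_oaddr _ _); apply: le_lt_trans wv _.
    by rewrite lt_oadd2l.
  - apply: (le_lt_trans wv); apply: (@le_lt_trans _ _ (x + (y + u))).
      by rewrite le_oadd2l.
    by rewrite IH// lt_oadd2l.
move=> /lt_oaddP[/lt_oaddP[wx|[v vy wv]]|[u uz]].
- exact: lt_le_trans (le_oaddr _ _).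
- apply: le_lt_trans wv _; rewrite lt_oadd2l.
  exact: lt_le_trans (le_oaddr _ _).
- by rewrite -IH// => /le_lt_trans; apply; rewrite !lt_oadd2l.
Qed.

HB.instance Definition _ := Monoid.isLaw.Build Ord 0 oadd oaddA add0o oadd0.

Lemma le_oaddl x y : y <= x + y.
Proof. by rewrite -{1}[y]add0o le_oadd2r// ozero_le. Qed.

Lemma oadd_sub x y : x <= y -> exists z, y = x + z.
Proof.
move=> xy; have [|yz zmin] := leastP (A := [set z | y <= x + z]).
  by exists y; exact: le_oaddl.
exists (least [set z | y <= x + z]); apply: le_anti; rewrite yz leNgt.
apply/negP => /lt_oaddP[|[v vl yv]]; first by rewrite ltNge xy.
by have := zmin v yv; rewrite leNgt vl.
Qed.

(** * Multiples and powers of omega *)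

Lemma lt_omegaP w : w < oomega <-> exists n, w = ord_of_nat n.
Proof.
split=> [/lt_lsubP[n]|[n ->]]; last by apply/lt_lsubP; exists n.
elim: n w => [|n IH] w; first by rewrite leo0 => /eqP ->; exists 0%N.
rewrite le_eqVlt => /predU1P[->|]; first by exists n.+1.
by rewrite lt_osucc; exact: IH.
Qed.

Lemma omega_limit : is_limit oomega.
Proof.
split=> [E|g E].
  by have : 0 < oomega; [apply/lt_omegaP; exists 0%N|rewrite E ltxx].
have /lt_omegaP[n gn] : g < oomega by rewrite -E osucc_lt.
have : osucc g < oomega by apply/lt_omegaP; exists n.+1; rewrite gn.
by rewrite E ltxx.
Qed.

Lemma lt_omul_omegaP x w : w < x * oomega <-> exists n, w < x * ord_of_nat n.
Proof.
rewrite {1}/omul lt_trec_limit; last exact: omega_limit.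
split=> [[g /lt_omegaP[n ->]]|[n wn]]; first by exists n.
by exists (ord_of_nat n) => //; apply/lt_omegaP; exists n.
Qed.

Lemma omul_natD x m n :
  x * ord_of_nat (m + n) = x * ord_of_nat m + x * ord_of_nat n.
Proof.
elim: n => [|n IH]; first by rewrite addn0 [ord_of_nat 0]/= omul0 oadd0.
by rewrite addnS [ord_of_nat _.+1]/= omulS IH [ord_of_nat n.+1]/= omulS oaddA.
Qed.

Lemma omul1 x : x * 1 = x.
Proof. by rewrite omulS omul0 add0o. Qed.

Lemma le_omul_nat x m n : (m <= n)%N -> x * ord_of_nat m <= x * ord_of_nat n.
Proof. by move=> /subnKC <-; rewrite omul_natD le_oaddr. Qed.

Lemma lt_powS g w : w < oomega ^ osucc g <-> exists n, w < oomega ^ g * ord_of_nat n.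
Proof. by rewrite oexpS lt_omul_omegaP. Qed.

Lemma lt_pow_limit h w : is_limit h ->
  w < oomega ^ h <-> exists2 g, g < h & w < oomega ^ g.
Proof. by move=> hl; rewrite {1}/oexp lt_trec_limit. Qed.

Lemma pow_gt0 g : 0 < oomega ^ g.
Proof.
elim/lt_ord_ind: g => g IH; case: (ordP g) => [->|h hE|gl].
- by rewrite oexp0 osucc_lt.
- by rewrite hE; apply/lt_powS; exists 1%N; rewrite omul1 IH// hE osucc_lt.
- by apply/lt_pow_limit => //; exists 0; [exact: limit_gt0|rewrite oexp0 osucc_lt].
Qed.

Lemma pow_ltS g : oomega ^ g < oomega ^ osucc g.
Proof.
by apply/lt_powS; exists 2%N; rewrite [ord_of_nat 2]/= omulS omul1 lt_oaddr pow_gt0.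
Qed.

Lemma pow_lt g h : g < h -> oomega ^ g < oomega ^ h.
Proof.
elim/lt_ord_ind: h => h IH gh; case: (ordP h) gh IH => [->|k ->|hl] gh IH.
- by move: gh; rewrite ltNge ozero_le.
- move: gh; rewrite lt_osucc le_eqVlt => /predU1P[->|gk]; first exact: pow_ltS.
  by apply: lt_trans (pow_ltS _); apply: IH => //; exact: osucc_lt.
- apply/lt_pow_limit => //; exists (osucc g); last exact: pow_ltS.
  exact: limit_lt.
Qed.

Lemma lt_pow2 g h : (oomega ^ g < oomega ^ h) = (g < h).
Proof.
apply/idP/idP; last exact: pow_lt.
by apply: contraTT; rewrite -!leNgt le_eqVlt => /predU1P[->//|/pow_lt/ltW].
Qed.

Lemma le_pow2 g h : (oomega ^ g <= oomega ^ h) = (g <= h).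
Proof. by rewrite !leNgt lt_pow2. Qed.

(** Merges the successor and limit clauses. It fails at [g = 0], since 0 lies below
    [oomega ^ 0 = 1]. *)
Lemma lt_powP g w : 0 < g ->
  w < oomega ^ g <-> exists2 h, h < g & exists n, w < oomega ^ h * ord_of_nat n.
Proof.
move=> g0; split=> [|[h hg /lt_powS wh]]; last first.
  by apply: lt_le_trans wh _; rewrite le_pow2 osucc_le.
case: (ordP g) g0 => [->|h ->|gl] g0; first by rewrite ltxx in g0.
  by move=> /lt_powS; exists h => //; exact: osucc_lt.
move=> /lt_pow_limit -/(_ gl)[h hg wh]; exists h => //.
by exists 1%N; rewrite omul1.
Qed.

(** For positive [g], both summands lie below finite multiples of one smaller power, that of the
    larger of their exponents. *)
Lemma pow_add u v g : u < oomega ^ g -> v < oomega ^ g -> u + v < oomega ^ g.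
Proof.
have [->|] := eqVneq g 0.
  rewrite oexp0 !lt_osucc !leo0 => /eqP -> /eqP ->.
  by rewrite oadd0.
rewrite -lt0o => g0 /lt_powP -/(_ g0)[h hg [m um]] /lt_powP -/(_ g0)[k kg [n vn]].
have up w a b i : w < oomega ^ a * ord_of_nat i -> a <= b ->
    exists j, w < oomega ^ b * ord_of_nat j.
  move=> wi; rewrite le_eqVlt => /predU1P[<-|ab]; first by exists i.
  exists 1%N; rewrite omul1; apply/lt_powP.
    exact: le_lt_trans (ozero_le a) ab.
  by exists a => //; exists i.
have [|j uj] := up _ _ (Order.max h k) _ um; first by rewrite le_max lexx.
have [|i vi] := up _ _ (Order.max h k) _ vn; first by rewrite le_max lexx orbT.
apply/lt_powP => //; exists (Order.max h k); first by rewrite gt_max hg.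
exists (j + i)%N; rewrite omul_natD; apply: le_lt_trans (le_oadd2r _ (ltW uj)) _.
by rewrite lt_oadd2l.
Qed.

Lemma add_pow u g : u < oomega ^ g -> u + oomega ^ g = oomega ^ g.
Proof.
move=> ug; apply: ord_ext => w; split=> [/lt_oaddP[wu|[v vg wv]]|wg].
- exact: lt_trans ug.
- by apply: le_lt_trans wv _; exact: pow_add.
- exact: lt_le_trans (le_oaddl _ _).
Qed.

Lemma le_pow x : x <= oomega ^ x.
Proof.
elim/lt_ord_ind: x => x IH; rewrite leNgt; apply/negP => lt.
by have := IH _ lt; rewrite leNgt pow_lt.
Qed.

(** Splits off the leading term: the least [l] with [x < oomega ^ l] yields the exponent, the least
    multiple exceeding [x] the coefficient. *)
Lemma lt_pow_decomp x g : 0 < x -> x < oomega ^ g ->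
  exists h m y, [/\ h < g, y < oomega ^ h & x = oomega ^ h * ord_of_nat m.+1 + y].
Proof.
move=> x0 xg; have := @leastP [set h | x < oomega ^ h] (ex_intro _ g xg).
move: (least _) => l [xl lmin].
have l0 : 0 < l.
  rewrite lt0o; apply/eqP => E; move: xl; rewrite E /= oexp0 lt_osucc leo0.
  by rewrite gt_eqF.
have /lt_powP -/(_ l0)[h hl xn] := xl.
case: (ex_minnP xn) => -[|n] xn' nmin.
  by move: xn'; rewrite [ord_of_nat 0]/= omul0 ltNge ozero_le.
have nx : oomega ^ h * ord_of_nat n <= x.
  by rewrite leNgt; apply/negP => /nmin; rewrite ltnn.
have [y xE] := oadd_sub nx; exists h; case: n => [|m] in xn' nmin nx xE *.
  (* A zero coefficient would mean [x < oomega ^ h] with [h < l], against the choice of [l]. *)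
  by have := lmin h; rewrite leNgt hl /= -[oomega ^ h]omul1 => /(_ xn').
exists m, y; split=> //; first exact: lt_le_trans (lmin _ xg).
by move: xn'; rewrite [ord_of_nat m.+2]/= omulS xE lt_oadd2l.
Qed.

(** * Cantor normal forms and natural sums *)

Lemma gt_trans : transitive (>%O : rel Ord).
Proof. by move=> y x z /= yx zy; exact: lt_trans zy yx. Qed.

Lemma gt_irr : irreflexive (>%O : rel Ord).
Proof. by move=> x /=; exact: ltxx. Qed.

(** Coefficients are indexed by exponents, not by positions in [s], so that two normal forms can be
    padded with zeros to a common list. *)
Definition cnfs (s : seq Ord) (L : Ord -> nat) : Ord :=
  \big[oadd/0]_(x <- s) (oomega ^ x * ord_of_nat (L x)).

Lemma cnfs_cons x s L :
  cnfs (x :: s) L = oomega ^ x * ord_of_nat (L x) + cnfs s L.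
Proof. exact: big_cons. Qed.

Lemma eq_cnfs s L M : {in s, L =1 M} -> cnfs s L = cnfs s M.
Proof. by move=> LM; apply: eq_big_seq => x /LM ->. Qed.

Lemma cnfs_lt_pow x s L : path >%O x s -> cnfs s L < oomega ^ x.
Proof.
elim: s x => [|y s IH] x; first by rewrite /cnfs big_nil pow_gt0.
move=> /= /andP[yx /IH ys]; rewrite cnfs_cons.
apply: lt_le_trans (_ : oomega ^ osucc y <= _); last by rewrite le_pow2 osucc_le.
apply/lt_powS; exists (L y).+1.
by rewrite [ord_of_nat _.+1]/= omulS lt_oadd2l.
Qed.

Fixpoint lex_lt (s : seq Ord) (L M : Ord -> nat) : bool :=
  if s is x :: s' then (L x < M x)%N || (L x == M x) && lex_lt s' L M
  else false.

Lemma cnfs_lex_lt s L M : sorted >%O s -> lex_lt s L M -> cnfs s L < cnfs s M.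
Proof.
elim: s => //= x s IH ps; rewrite !cnfs_cons => /orP[LM|/andP[/eqP -> /IH]].
  apply: lt_le_trans (le_oaddr _ _).
  apply: lt_le_trans (le_omul_nat _ LM).
  by rewrite [ord_of_nat _.+1]/= omulS lt_oadd2l cnfs_lt_pow.
by rewrite lt_oadd2l; apply; exact: path_sorted ps.
Qed.

Variant lex_spec (s : seq Ord) (L M : Ord -> nat) : Prop :=
| LexLt of lex_lt s L M
| LexEq of {in s, L =1 M}
| LexGt of lex_lt s M L.

Lemma lexP s L M : lex_spec s L M.
Proof.
elim: s => [|x s [lt|eq|gt]]; first exact: LexEq.
- case: (ltngtP (L x) (M x)) => [LM|ML|E].
  + by apply: LexLt; rewrite /= LM.
  + by apply: LexGt; rewrite /= ML.
  + by apply: LexLt; rewrite /= E eqxx lt orbT.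
- case: (ltngtP (L x) (M x)) => [LM|ML|E].
  + by apply: LexLt; rewrite /= LM.
  + by apply: LexGt; rewrite /= ML.
  + by apply: LexEq => y; rewrite inE => /predU1P[->//|/eq].
- case: (ltngtP (L x) (M x)) => [LM|ML|E].
  + by apply: LexLt; rewrite /= LM.
  + by apply: LexGt; rewrite /= ML.
  + by apply: LexGt; rewrite /= E eqxx gt orbT.
Qed.

Lemma lex_ltP s L M : sorted >%O s -> lex_lt s L M = (cnfs s L < cnfs s M).
Proof.
move=> ss; apply/idP/idP; first exact: cnfs_lex_lt.
case: (lexP s L M) => [//|/eq_cnfs ->|/(cnfs_lex_lt ss)]; first by rewrite ltxx.
by move=> /ltW; rewrite leNgt => /negbTE ->.
Qed.

Lemma lex_ltD s L L' M M' : lex_lt s L L' ->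
  lex_lt s M M' \/ {in s, M =1 M'} ->
  lex_lt s (fun x => L x + M x)%N (fun x => L' x + M' x)%N.
Proof.
elim: s => //= x s IH /orP[LL|/andP[/eqP LL Ls]] [/orP[MM|/andP[/eqP MM Ms]]|ME].
- by rewrite -addSn leq_add// ltnW.
- by rewrite MM ltn_add2r LL.
- by rewrite ME ?mem_head// ltn_add2r LL.
- by rewrite LL ltn_add2l MM.
- by rewrite LL MM eqxx IH ?orbT//; left.
- rewrite LL ME ?mem_head// eqxx IH ?orbT//; right=> y ys.
  by rewrite ME// inE ys orbT.
Qed.

Lemma cnfs_ext (s t : seq Ord) L : sorted >%O s -> sorted >%O t -> {subset s <= t} ->
  cnfs t (fun x => if x \in s then L x else 0%N) = cnfs s L.
Proof.
move=> ss st sub; have fE : [seq x <- t | x \in s] = s.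
  apply: (irr_sorted_eq gt_trans gt_irr) => //.
    exact: sorted_filter gt_trans _ _ st.
  by move=> x; rewrite mem_filter; apply/andP/idP => [[]//|xs]; split=> //; exact: sub.
rewrite {2}/cnfs -[X in \big[_/_]_(_ <- X) _]fE big_filter big_mkcond /cnfs; apply: eq_bigr => x _.
by case: ifP => // _; rewrite omul0.
Qed.

Lemma sorted_merge (s t : seq Ord) : exists2 u, sorted >%O u & {subset s ++ t <= u}.
Proof.
exists (rev (sort <=%O (undup (s ++ t)))).
  rewrite rev_sorted lt_sorted_uniq_le sort_uniq undup_uniq /=.
  exact: sort_le_sorted.
by move=> x xst; rewrite mem_rev mem_sort mem_undup.
Qed.

Lemma index_enum_ord n : index_enum 'I_n = enum 'I_n.
Proof. by rewrite /index_enum unlock enumT. Qed.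

Lemma natsum_specP a b c : natsum_spec a b c <-> exists s L M,
  [/\ sorted >%O s, a = cnfs s L, b = cnfs s M & c = cnfs s (fun x => L x + M x)%N].
Proof.
split=> [[n [g [l [m [gdec -> -> ->]]]]]|[s [L [M [ss -> -> ->]]]]].
  have ginj : injective g.
    move=> i j gij; apply: val_inj; case: (ltngtP i j) => // /gdec.
      by rewrite gij ltxx.
    by rewrite gij ltxx.
  (* Transports coefficients from indices to exponents; injectivity of [g] makes this faithful. *)
  pose ext (f : 'I_n -> nat) x := if [pick i | g i == x] is Some i then f i else 0%N.
  have extE f j : ext f (g j) = f j.
    rewrite /ext; case: pickP => [i /eqP/ginj -> //|/(_ j)].
    by rewrite eqxx.
  have cnfE f L : (forall j, L (g j) = f j) -> cnf g f = cnfs [seq g i | i <- enum 'I_n] L.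
    move=> Lf; rewrite /cnfs big_map -index_enum_ord /cnf; apply: eq_bigr => j _.
    by rewrite Lf.
  exists [seq g i | i <- enum 'I_n], (ext l), (ext m); split.
  - rewrite sorted_map; have : sorted ltn [seq val i | i <- enum 'I_n].
      by rewrite val_enum_ord iota_ltn_sorted.
    by rewrite sorted_map; apply: sub_sorted => i j /=; exact: gdec.
  - exact: cnfE.
  - exact: cnfE.
  - by apply: cnfE => j; rewrite !extE.
have cnfE K : cnfs s K = cnf (fun i : 'I_(size s) => nth 0 s i) (fun i => K (nth 0 s i)).
  by rewrite /cnfs (big_nth 0) big_mkord.
exists (size s), (fun i => nth 0 s i), (fun i => L (nth 0 s i)), (fun i => M (nth 0 s i)).
split=> // i j ij.
by apply: (sorted_ltn_nth gt_trans 0 ss) => //; rewrite inE.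
Qed.

Lemma cnfs_exists h x : x < oomega ^ h -> exists s L, path >%O h s /\ x = cnfs s L.
Proof.
elim/lt_ord_ind: x h => x IH h; have [->|] := eqVneq x 0.
  by exists [::], (fun=> 0%N); rewrite /cnfs big_nil.
rewrite -lt0o => x0 /(lt_pow_decomp x0)[k [m [y [kh yk xE]]]].
have yx : y < x.
  apply: lt_le_trans yk _; rewrite xE; apply: le_trans (le_oaddr _ _).
  by rewrite -{1}[oomega ^ k]omul1 (@le_omul_nat _ 1).
have [s [L [ps yE]]] := IH _ yx _ yk.
exists (k :: s), (fun z => if z == k then m.+1 else L z); split=> /=.
  by rewrite kh ps.
rewrite cnfs_cons eqxx xE yE; congr (_ + _); apply: eq_cnfs => z zs.
case: eqP => // zk; have /allP/(_ z zs) := order_path_min gt_trans ps.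
by rewrite zk /= ltxx.
Qed.

Lemma cnfs_common x y : exists s L M, [/\ sorted >%O s, x = cnfs s L & y = cnfs s M].
Proof.
have cx z : exists s L, sorted >%O s /\ z = cnfs s L.
  have [s [L [ps zE]]] := @cnfs_exists (osucc z) z (le_lt_trans (le_pow z) (pow_ltS z)).
  by exists s, L; split=> //; exact: path_sorted ps.
have [s [L [ss ->]]] := cx x; have [t [M [st ->]]] := cx y.
have [u su sub] := sorted_merge s t.
exists u, (fun x => if x \in s then L x else 0%N), (fun x => if x \in t then M x else 0%N).
split=> //; apply/esym/cnfs_ext => // z zs; apply: sub; rewrite mem_cat zs//.
exact: orbT.
Qed.

Lemma natsumP a b : natsum_spec a b (natsum a b).
Proof.
apply: xgetPex; have [s [L [M [ss aE bE]]]] := cnfs_common a b.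
exists (cnfs s (fun x => L x + M x)%N); apply/natsum_specP.
by exists s, L, M.
Qed.

(** On a common list of exponents, normal forms are ordered lexicographically by their coefficients,
    and pointwise addition respects this order. *)
Lemma natsum_spec_le a b c a' b' c' : natsum_spec a b c -> natsum_spec a' b' c' ->
  a <= a' -> b <= b' -> c <= c' /\ (a < a' \/ b < b' -> c < c').
Proof.
move=> /natsum_specP[s [L [M [ss -> -> ->]]]] /natsum_specP[t [L' [M' [st -> -> ->]]]].
have [u su sub] := sorted_merge s t.
have subs : {subset s <= u} by move=> z zs; apply: sub; rewrite mem_cat zs.
have subt : {subset t <= u} by move=> z zs; apply: sub; rewrite mem_cat zs orbT.
pose ext (r : seq Ord) (K : Ord -> nat) x := if x \in r then K x else 0%N.
have extD r K N x : ext r (fun x => K x + N x)%N x = (ext r K x + ext r N x)%N.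
  by rewrite /ext; case: ifP.
rewrite -!(cnfs_ext _ ss su subs) -!(cnfs_ext _ st su subt).
rewrite -!/(ext _ _) (eq_cnfs (in1W (extD s L M))) (eq_cnfs (in1W (extD t L' M'))).
have leE K N : cnfs u K <= cnfs u N -> lex_lt u K N \/ {in u, K =1 N}.
  case: (lexP u K N) => [|?|lt]; [by left|by right|].
  by rewrite leNgt cnfs_lex_lt.
move=> /leE LL /leE MM.
have lt : lex_lt u (ext s L) (ext t L') \/ lex_lt u (ext s M) (ext t M') ->
    cnfs u (fun x => ext s L x + ext s M x)%N < cnfs u (fun x => ext t L' x + ext t M' x)%N.
  move=> [lt|lt]; first by apply: cnfs_lex_lt => //; exact: lex_ltD.
  apply: cnfs_lex_lt => //.
  have := lex_ltD lt LL; set X := lex_lt _ _ _; set Y := lex_lt _ _ _.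
  suff -> : X = Y by [].
  by rewrite /X /Y; congr lex_lt; apply/funext => z; rewrite addnC.
split; last by move=> [|]; rewrite -lex_ltP// => ?; apply: lt; [left|right].
case: LL lt => [LL|LL] lt; first by apply/ltW/lt; left.
case: MM lt => [MM|MM] lt; first by apply/ltW/lt; right.
by rewrite le_eqVlt; apply/orP; left; apply/eqP/eq_cnfs => z zu; rewrite LL// MM.
Qed.

Lemma le_natsum a b a' b' : a <= a' -> b <= b' -> natsum a b <= natsum a' b'.
Proof. by move=> aa bb; have [] := natsum_spec_le (natsumP a b) (natsumP a' b') aa bb. Qed.

Lemma lt_natsum a b a' b' : a <= a' -> b <= b' -> a < a' \/ b < b' ->
  natsum a b < natsum a' b'.
Proof. by move=> aa bb; have [_] := natsum_spec_le (natsumP a b) (natsumP a' b') aa bb. Qed.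

Lemma le_big_natsum k (a b : 'I_k -> Ord) : (forall i, a i <= b i) ->
  \big[natsum/0]_(i < k) a i <= \big[natsum/0]_(i < k) b i.
Proof.
move=> ab; elim/big_rec2: _ => // i x y _ xy; exact: le_natsum.
Qed.

Lemma lt_big_natsum k (a b : 'I_k -> Ord) j : (forall i, a i <= b i) -> a j < b j ->
  \big[natsum/0]_(i < k) a i < \big[natsum/0]_(i < k) b i.
Proof.
elim: k a b j => [|k IH] a b j ab abj; first by case: j abj.
rewrite !big_ord_recl; apply: lt_natsum => //; first exact: le_big_natsum.
case: (unliftP ord0 j) abj => [i ->|->] abj; last by left.
by right; exact: IH abj.
Qed.

(** * Splitting a natural sum into its summands *)

(* [c] is a disjoint union of sets of order types at most [alpha i] *)
Definition interleaved (I : Type) (c : Ord) (alpha : I -> Ord) : Prop :=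
  exists (C : Ord -> I) (f : Ord -> Ord), (forall d, d < c -> f d < alpha (C d)) /\
    forall d e, d < e -> e < c -> C d = C e -> f d < f e.

Lemma interleaved_add (I : eqType) c (alpha : I -> Ord) j r : interleaved c alpha ->
  interleaved (c + r) (fun i => if i == j then alpha i + r else alpha i).
Proof.
move=> [C [f [fC fS]]].
have [sub subE] : {sub : Ord -> Ord | forall d, c <= d -> d = c + sub d}.
  apply/cid; suff /choice[g gP] : forall d, exists z, c <= d -> d = c + z.
    by exists g.
  move=> d; have [/oadd_sub[z dz]|cd] := leP c d; first by exists z.
  by exists 0.
exists (fun d => if d < c then C d else j).
exists (fun d => if d < c then f d else alpha j + sub d).
split=> [d|d e de] dc.
  case: (ltP d c) => [dc'|/subE dE]; last by rewrite eqxx lt_oadd2l -(lt_oadd2l c) -dE.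
  have := fC _ dc'; case: eqP => // _ /lt_le_trans; apply; exact: le_oaddr.
have [ec|/subE eE] := ltP e c; first by rewrite (lt_trans de ec); exact: fS.
case: (ltP d c) => [dc' <-|/subE dE _]; first by apply: lt_le_trans (fC _ dc') (le_oaddr _ _).
by rewrite lt_oadd2l -(lt_oadd2l c) -dE -eE.
Qed.

Lemma eq_interleaved I c (a b : I -> Ord) : a =1 b -> interleaved c a -> interleaved c b.
Proof. by move=> /funext ->. Qed.

(** Each term of the common normal form adds a block for [a] followed by a block for [b]; terms are
    appended on the right, hence [last_ind]. *)
Lemma interleaved_natsum a b : interleaved (natsum a b) (fun i : bool => if i then a else b).
Proof.
have /natsum_specP[s [L [M [_ -> -> ->]]]] := natsumP a b.
elim/last_ind: s => [|s x IH].
  rewrite /cnfs !big_nil; exists (fun=> true), (fun=> 0).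
  by split=> [d|d e _]; rewrite ltNge ozero_le.
rewrite /cnfs !big_rcons /= omul_natD oaddA.
have := interleaved_add false (oomega ^ x * ord_of_nat (M x))
  (interleaved_add true (oomega ^ x * ord_of_nat (L x)) IH).
by apply: eq_interleaved; case.
Qed.

(** With colours in [nat], prefixing an ordinal shifts colours by one. A colour beyond the list
    would need a position below the default 0, so none occurs. *)
Lemma interleaved_foldr (s : seq Ord) : interleaved (foldr natsum 0 s) (nth 0 s).
Proof.
elim: s => [|a s [C [f [fC fS]]]].
  by exists (fun=> 0%N), (fun=> 0); split=> [d|d e _]; rewrite ltNge ozero_le.
have [D [g [gD gS]]] := interleaved_natsum a (foldr natsum 0 s).
exists (fun d => if D d then 0%N else (C (g d)).+1), (fun d => if D d then g d else f (g d)).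
split=> [d /gD|d e de ec].
  by case: ifP => // _; exact: fC.
have := gS _ _ de ec; have := gD _ ec.
case: (D d); case: (D e) => // ge lt.
  by move=> _; exact: lt.
by move=> [Ce]; apply: fS => //; exact: lt.
Qed.

Lemma interleaved_big_natsum k (alpha : 'I_k -> Ord) : (0 < k)%N ->
  interleaved (\big[natsum/0]_(i < k) alpha i) alpha.
Proof.
case: k alpha => // k alpha _; pose s := [seq alpha i | i <- enum 'I_k.+1].
have -> : \big[natsum/0]_(i < k.+1) alpha i = foldr natsum 0 s.
  by rewrite index_enum_ord /s unlock /reducebig; elim: (enum _) => //= i r ->.
have [C [f [fC fS]]] := interleaved_foldr s.
have Ck d : d < foldr natsum 0 s -> (C d < k.+1)%N.
  move=> /fC; rewrite ltnNge; apply: contraTN => kC.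
  by rewrite nth_default ?ltNge ?ozero_le// size_map size_enum_ord.
exists (fun d => inord (C d)), f; split=> [d dc|d e de ec CE].
  have := fC d dc; rewrite (nth_map ord0) ?size_enum_ord ?Ck//.
  suff -> : nth ord0 (enum 'I_k.+1) (C d) = inord (C d) by [].
  by apply: val_inj; rewrite /= nth_enum_ord ?inordK// Ck.
apply: fS => //; have := congr1 (@nat_of_ord _) CE; rewrite !inordK//; apply: Ck => //.
exact: lt_trans ec.
Qed.

(** * Ranks of points in sets of ordinals *)

Lemma oomega1_bigcup (I : Type) (D : set I) (F : I -> set Ord) x : countable D ->
  (forall i, D i -> countable (F i)) -> [set w | w < x] `<=` \bigcup_(i in D) F i ->
  x < oomega1.
Proof.
move=> cD cF sub; apply/lt_oomega1; apply: sub_countable (bigcup_countable cD cF).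
exact: subset_card_le.
Qed.

Lemma oomega1S x : x < oomega1 -> osucc x < oomega1.
Proof.
move=> /lt_oomega1 cx.
apply: (@oomega1_bigcup bool setT (fun b => if b then [set w | w < x] else [set x])) => //.
  by move=> [] _ //; exact: countable1.
move=> w /=; rewrite lt_osucc le_eqVlt => /predU1P[->|wx]; first by exists false.
by exists true.
Qed.

(** Covers sums, multiples of [oomega] and powers of [oomega] at once; at a limit, a countable union
    of countable segments is countable. *)
Lemma trec_oomega1 z s b : z < oomega1 ->
  (forall y, y < oomega1 -> s y < oomega1) -> b < oomega1 -> trec z s b < oomega1.
Proof.
move=> z1 s1; elim/lt_ord_ind: b => b IH b1; case: (ordP b) => [->|g gb|bl].
- by rewrite trec0.
- have gb' : g < b by rewrite gb osucc_lt.
  by rewrite gb trecS; apply/s1/IH => //; exact: lt_trans b1.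
- have /lt_oomega1 cb := b1.
  apply: (oomega1_bigcup (F := fun g => [set w | w < trec z s g]) cb) => [g gb|w].
    by apply/lt_oomega1/IH => //; exact: lt_trans b1.
  by move=> /lt_trec_limit -/(_ bl)[g gb wg]; exists g.
Qed.

Lemma oexp_oomega1 b : b < oomega1 -> oomega ^ b < oomega1.
Proof.
have o1 : 0 < oomega1.
  by apply/lt_oomega1; rewrite (_ : mkset _ = set0)// -subset0 => x /=; rewrite ltNge ozero_le.
have add1 x y : x < oomega1 -> y < oomega1 -> x + y < oomega1.
  by move=> x1 y1; apply: trec_oomega1 => //; exact: oomega1S.
have omega1 : oomega < oomega1.
  apply: (@oomega1_bigcup nat setT (fun n => [set ord_of_nat n])) => //.
  by move=> w /lt_omegaP[n ->]; exists n.
move=> b1; apply: trec_oomega1 => //; first exact: oomega1S.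
by move=> y y1; apply: trec_oomega1 => // w w1; exact: add1.
Qed.

(** Each colour class is countable, as [f] maps it injectively below [alpha i]. Natural sums are
    thus countable without a look at their exponents. *)
Lemma interleaved_oomega1 (I : countType) c (alpha : I -> Ord) :
  interleaved c alpha -> (forall i, alpha i < oomega1) -> c < oomega1.
Proof.
move=> [C [f [fC fS]]] a1.
apply: (@oomega1_bigcup I setT (fun i => [set w | w < c /\ C w = i])) => //.
  move=> i _; have /lt_oomega1/countable_injP[g ginj] := a1 i.
  apply/countable_injP; exists (g \o f) => v w /set_mem[vc vi] /set_mem[wc wi] /=.
  have mem u : u < c -> C u = i -> f u \in [set x | x < alpha i].
    by move=> uc ui; apply/mem_set; rewrite /= -ui fC.
  move=> /ginj; rewrite !mem// => /(_ isT isT) fE.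
  case: (ltgtP v w) => // vw.
    by have := fS _ _ vw wc; rewrite fE ltxx vi wi => /(_ erefl).
  by have := fS _ _ vw vc; rewrite fE ltxx vi wi => /(_ erefl).
by move=> w wc; exists (C w).
Qed.

(** Takes running maxima of an enumeration. The weak inequality allows an eventually constant
    sequence, so successors and limits are treated alike. *)
Lemma cofinal_seq x : 0 < x -> x < oomega1 -> exists e : nat -> Ord,
  (forall n, e n < x) /\ forall w, w < x -> exists N, forall n, (N <= n)%N -> w <= e n.
Proof.
move=> x0 /lt_oomega1/pfcard_geP[E|[p]].
  by have : [set y | y < x] 0 by []; rewrite E.
pose e := fix e n := if n is m.+1 then Order.max (e m) (p n) else p 0%N.
have px n : p n < x by exact: (@funS _ _ _ _ p n I).
have ple n : p n <= e n by case: n => [|n] //=; rewrite le_max lexx orbT.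
exists e; split=> [|w wx].
  by elim=> [|n IH] /=; rewrite ?gt_max ?IH px.
have [N _ pN] := @surj _ _ _ _ p _ wx.
exists N => n /subnKC <-; rewrite -pN; elim: (n - N)%N => [|i IH]; first by rewrite addn0 ple.
by rewrite addnS /= le_max IH.
Qed.

(* Cantor-Bendixson rank of [x] in the subspace [X `|` [set x]] being at least
   [d]; in an ordinal only the points below [x] are relevant. *)
Inductive rank_ge (X : set Ord) (d x : Ord) : Prop :=
  RankGe of forall e, e < d -> 0 < x /\
    forall z, z < x -> exists y, [/\ z < y, y < x, X y & rank_ge X e y].

Lemma rank_ge_le X d e x : rank_ge X d x -> e <= d -> rank_ge X e x.
Proof. by move=> [xd] ed; split=> e' e'e; apply: xd; exact: lt_le_trans ed. Qed.

Lemma rank_geN X d x : ~ rank_ge X d x <-> exists2 e, e < d &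
  x = 0 \/ exists2 z, z < x & forall y, z < y -> y < x -> X y -> ~ rank_ge X e y.
Proof.
split=> [nxd|[e ed zx] [/(_ e ed)[x0 xd]]]; last first.
  case: zx xd x0 => [->|[z zx nz] /(_ z zx)[y [zy yx Xy ye]] _]; first by rewrite ltxx.
  exact: nz ye.
apply: contrapT => n; apply: nxd; split=> e ed.
have [x0|/eqP x0] := eqVneq x 0; first by exfalso; apply: n; exists e => //; left.
split=> [|z zx]; first by rewrite lt0o; apply/eqP.
apply: contrapT => nz; apply: n; exists e => //; right; exists z => // y zy yx Xy ye.
by apply: nz; exists y.
Qed.

(** Some [e < a (C y)] bounds the rank of [y] in its own colour. Replacing [a (C y)] by [e] lowers
    the natural sum strictly, so the induction hypothesis applies. *)
Lemma rank_ge_natsum_step k (C : Ord -> 'I_k) (a : 'I_k -> Ord) x :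
  (forall g, g < \big[natsum/0]_(i < k) a i -> forall b,
     g = \big[natsum/0]_(i < k) b i ->
     forall y, y <= x -> (forall i, ~ rank_ge (C @^-1` [set i]) (osucc (b i)) y) ->
     ~ rank_ge setT (osucc g) y) ->
  forall y, y <= x -> ~ rank_ge (C @^-1` [set C y]) (a (C y)) y ->
  (forall i, i != C y -> ~ rank_ge (C @^-1` [set i]) (osucc (a i)) y) ->
  ~ rank_ge setT (\big[natsum/0]_(i < k) a i) y.
Proof.
move=> IH y yx /rank_geN[e ea ye] yi yrank.
pose b i := if i == C y then e else a i.
have lt : \big[natsum/0]_(i < k) b i < \big[natsum/0]_(i < k) a i.
  apply: (@lt_big_natsum _ _ _ (C y)) => [i|]; rewrite /b ?eqxx//.
  by case: eqP => // ->; exact: ltW.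
apply: (IH _ lt b erefl _ yx); last by apply: rank_ge_le yrank _; rewrite osucc_le.
move=> i; rewrite /b; case: eqVneq => [->|/yi//].
by apply/rank_geN; exists e => //; exact: osucc_lt.
Qed.

(* With [r_i] the rank of [x] in colour [i], some neighbourhood of [x] has, for
   every [i], all points of colour [i] other than [x] of rank less than [r_i] in
   that colour; so moving from [x] to a point of colour [i] in it decreases the
   natural sum of the ranks. *)
Lemma rank_ge_natsum k (C : Ord -> 'I_k) (a : 'I_k -> Ord) x :
  (forall i, ~ rank_ge (C @^-1` [set i]) (osucc (a i)) x) ->
  ~ rank_ge setT (osucc (\big[natsum/0]_(i < k) a i)) x.
Proof.
move gE: (\big[natsum/0]_(i < k) a i) => g.
elim/lt_ord_ind: g a gE x => g IH a gE x xa [/(_ g (osucc_lt g))[x0 xg]].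
have /choice[z zP] : forall i, exists z, z < x /\
    forall y, z < y -> y <= x -> y != x -> C y = i -> ~ rank_ge (C @^-1` [set i]) (a i) y.
  move=> i; have /rank_geN[e] := xa i; rewrite lt_osucc => ea [E|[z zx zP]].
    by rewrite E ltxx in x0.
  exists z; split=> // y zy yx yx' yi yr; apply: (zP y) => //.
    by rewrite lt_neqAle yx'.
  exact: rank_ge_le ea.
(* The interval from [m] to [x] serves all the finitely many colours at once. *)
pose m := \big[Order.max/0]_(i < k) z i.
have mx : m < x by apply/bigmax_ltP; split=> // i _; exact: (zP i).1.
have [y [my yx _ yr]] := xg _ mx.
have zy i : z i < y by apply: le_lt_trans my; exact: le_bigmax.
move: yr; rewrite -gE; apply: (@rank_ge_natsum_step _ C a y) => //.
- by move=> h hg b hb w _; apply: IH => //; rewrite -gE.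
- by apply: (zP _).2 => //; rewrite ?ltW// lt_eqF.
(* The points of colour [i] just below [y] have rank less than [a i], so [y] has rank at most [a i]
   there. *)
- move=> i _; apply/rank_geN; exists (a i); first exact: osucc_lt.
  right; exists (z i) => // w zw wy wi; apply: (zP i).2 => //.
    exact/ltW/(lt_trans wy).
  by rewrite lt_eqF// (lt_trans wy).
Qed.

(** Otherwise every point of colour [i] up to [x] has rank below [a i] in its colour. Then [x] has
    rank below [a (C x)] in its own colour and at most [a i] in the others, against
    [rank_ge_natsum_step]. *)
Lemma rank_ge_colour k (C : Ord -> 'I_k) (a : 'I_k -> Ord) x :
  rank_ge setT (\big[natsum/0]_(i < k) a i) x ->
  exists2 y, y <= x & rank_ge (C @^-1` [set C y]) (a (C y)) y.
Proof.
move=> xa; apply: contrapT => n; apply: (@rank_ge_natsum_step _ C a x) xa => //.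
- by move=> g _ b -> y _; exact: rank_ge_natsum.
- by move=> xr; apply: n; exists x.
- move=> i _; apply/rank_geN; exists (a i); first exact: osucc_lt.
  have [->|/eqP x0] := eqVneq x 0; first by left.
  right; exists 0; first by rewrite lt0o; exact/eqP.
  by move=> y _ yx yi yr; apply: n; exists y; rewrite ?ltW// yi.
Qed.

(** For [e < g], the points [u + v + oomega ^ e] with [v < oomega ^ g] are cofinal below and have
    rank at least [e] by induction, which needs the offset [u]. *)
Lemma rank_ge_pow g u : rank_ge setT g (u + oomega ^ g).
Proof.
elim/lt_ord_ind: g u => g IH u; split=> e eg; split=> [|z].
  exact: lt_le_trans (pow_gt0 g) (le_oaddl _ _).
move=> /lt_oaddP[zu|[v vg zv]].
  exists (u + oomega ^ e); split=> //; [|by rewrite lt_oadd2l lt_pow2|exact: IH].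
  exact: lt_le_trans (le_oaddr _ _).
exists (u + v + oomega ^ e); split=> //; last exact: IH.
  by apply: le_lt_trans zv _; rewrite lt_oaddr pow_gt0.
by rewrite -oaddA lt_oadd2l pow_add// lt_pow2.
Qed.

(** * Normal embeddings of powers of omega *)

(* Leaving 0 out of the domain [1, l] is what makes such maps concatenate. *)
Definition normal_into (X : set Ord) (z l : Ord) (f : Ord -> Ord) : Prop :=
  [/\ forall x, 0 < x -> x <= l -> X (f x) /\ z < f x,
      forall x y, 0 < x -> x < y -> y <= l -> f x < f y &
      forall x w, is_limit x -> x <= l -> w < f x ->
        exists2 v, 0 < v /\ v < x & w < f v].

Lemma limit_oadd x y : 0 < y -> is_limit (x + y) -> is_limit y.
Proof.
move=> y0 [_ xyS]; split=> [E|g E]; first by rewrite E ltxx in y0.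
by apply: (xyS (x + g)); rewrite -oaddS E.
Qed.

(* Concatenates embeddings of [1, omega ^ e n] into the part of [X] between [Y n]
   and [Y n.+1], for [e] cofinal in [a] and [Y] a sequence in [X] converging to [y]. *)
Lemma normal_into_pow_exists a X y z : a < oomega1 -> y < oomega1 -> X y ->
  rank_ge X a y -> z < y -> exists2 f, normal_into X z (oomega ^ a) f & f (oomega ^ a) = y.
Proof.
elim/lt_ord_ind: a y z => a IH y z a1 y1 Xy [ya] zy.
have [->|] := eqVneq a 0.
  (* For [a = 0] the domain is the single point 1. *)
  exists (fun=> y) => //; rewrite oexp0; split=> // [u v u0 uv|u w ul].
    move=> /(lt_le_trans uv); rewrite lt_osucc leo0 => /eqP E.
    by rewrite E ltxx in u0.
  by rewrite leNgt (limit_lt ul)// limit_gt0.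
rewrite -lt0o => a0; have y0 : 0 < y by exact: le_lt_trans (ozero_le z) zy.
have [e [ea ecof]] := cofinal_seq a0 a1.
have [d [dy dcof]] := cofinal_seq y0 y1.
(* The next point of [Y] is taken beyond [d n] as well, which makes [Y] converge to [y]. *)
have /choice[pick pickP] : forall p : nat * Ord, exists w, p.2 < y ->
    [/\ p.2 < w, d p.1 < w, w < y, X w & rank_ge X (e p.1) w].
  move=> [n w] /=; have [wy|_] := ltP w y; last by exists 0.
  have [_ /(_ (Order.max w (d n)))[]] := ya _ (ea n); first by rewrite gt_max wy dy.
  by move=> u [+ uy Xu ur]; rewrite gt_max => /andP[wu du]; exists u.
pose Y := fix Y n := if n is m.+1 then pick (m, Y m) else z.
have Yy n : Y n < y.
  by elim: n => [//|n IHn]; have [] := pickP (n, Y n) IHn.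
have YS n : [/\ Y n < Y n.+1, d n < Y n.+1, X (Y n.+1) & rank_ge X (e n) (Y n.+1)].
  by have [] := pickP (n, Y n) (Yy n).
have Yle m n : (m <= n)%N -> Y m <= Y n.
  move=> /subnKC <-; elim: (n - m)%N => [|i IHi]; rewrite ?addn0// addnS.
  by apply: le_trans IHi _; have [/ltW] := YS (m + i)%N.
have /choice[F FP] : forall n, exists f,
    normal_into X (Y n) (oomega ^ e n) f /\ f (oomega ^ e n) = Y n.+1.
  move=> n; have [YY _ XY Yr] := YS n.
  have [||f] := IH _ (ea n) _ _ _ _ XY Yr YY; last by exists f.
    exact: lt_trans a1.
  exact: lt_trans (Yy _) y1.
pose S := fix S n := if n is m.+1 then S m + oomega ^ e m else 0.
have Sle m n : (m <= n)%N -> S m <= S n.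
  move=> /subnKC <-; elim: (n - m)%N => [|i IHi]; rewrite ?addn0// addnS /=.
  exact: le_trans (le_oaddr _ _).
have Sa n : S n < oomega ^ a.
  by elim: n => [|n IHn] /=; rewrite ?pow_gt0// pow_add// lt_pow2.
have Scof w : w < oomega ^ a -> exists n, w < S n.
  move=> /lt_powP -/(_ a0)[h /ecof[N hN] [i wi]].
  (* From index [N] on every block has length at least [oomega ^ h], so [i] further blocks
     suffice. *)
  exists (N + i)%N; apply: lt_le_trans wi _; elim: i => [|i IHi].
    by rewrite [ord_of_nat 0]/= omul0 ozero_le.
  rewrite addnS [ord_of_nat _.+1]/= omulS /=; apply: le_trans (le_oadd2r _ IHi) _.
  by rewrite le_oadd2l le_pow2 hN// leq_addr.
(* Blocks are open on the left and closed on the right, so they partition the positive ordinals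
   below [oomega ^ a]. *)
pose block p x := [/\ 0 < p.2, p.2 <= oomega ^ e p.1 & x = S p.1 + p.2].
have /choice[b bP] : forall x, exists p, 0 < x -> x < oomega ^ a -> block p x.
  move=> x; have [/andP[x0 xa]|n] := boolP ((0 < x) && (x < oomega ^ a)); last first.
    by exists (0%N, 0) => x0 xa; rewrite x0 xa in n.
  have xS : exists n, x <= S n by have [n /ltW xn] := Scof _ xa; exists n.
  case: (ex_minnP xS) => -[|n] xn nmin; first by move: xn; rewrite leNgt x0.
  have Sx : S n < x by rewrite ltNge; apply/negP => /nmin; rewrite ltnn.
  have [v xE] := oadd_sub (ltW Sx); exists (n, v) => _ _; split=> //=.
    by move: Sx; rewrite {1}xE lt_oaddr.
  by move: xn; rewrite {1}xE le_oadd2l.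
have block_lt p q x x' : block p x -> block q x' -> (p.1 < q.1)%N -> x < x'.
  move=> [p0 pe ->] [q0 qe ->] pq; apply: (@le_lt_trans _ _ (S p.1.+1)).
    by rewrite /= le_oadd2l.
  by apply: le_lt_trans (Sle _ _ pq) _; rewrite lt_oaddr.
have block_uniq p q x : block p x -> block q x -> p = q.
  case: p q => [n v] [m w] px qx; case: (ltngtP n m) => nm.
  - by have := block_lt _ _ _ _ px qx nm; rewrite ltxx.
  - by have := block_lt _ _ _ _ qx px nm; rewrite ltxx.
  - by move: px qx; rewrite -nm => -[/= _ _ ->] [/= _ _ /oadd_inj ->].
have block_a p x : block p x -> 0 < x /\ x < oomega ^ a.
  move=> [p0 pe ->]; split; first exact: lt_le_trans (le_oaddl _ _).
  by apply: le_lt_trans (Sa p.1.+1); rewrite /= le_oadd2l.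
pose f x := if x < oomega ^ a then F (b x).1 (b x).2 else y.
have fE p x : block p x -> f x = F p.1 p.2.
  move=> px; have [x0 xa] := block_a _ _ px.
  by rewrite /f xa (block_uniq _ _ _ (bP _ x0 xa) px).
have FY p x : block p x -> Y p.1 < f x /\ f x <= Y p.1.+1.
  move=> px; have := px => -[p0 pe _]; rewrite (fE _ _ px).
  have [[F1 F2 _] FE] := FP p.1; split; first exact: (F1 _ p0 pe).2.
  rewrite -FE; move: pe; rewrite le_eqVlt => /predU1P[->//|pe].
  by apply/ltW/F2.
have fy x : 0 < x -> x < oomega ^ a -> f x < y.
  by move=> x0 xa; have [_ /le_lt_trans] := FY _ _ (bP _ x0 xa); apply.
have fa x : oomega ^ a <= x -> f x = y by rewrite /f leNgt; case: ifP.
exists f; last exact: fa.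
split=> [x x0|x x' x0 xx'|x w xl].
- rewrite le_eqVlt => /predU1P[->|xa]; first by rewrite fa.
  have [bx] := bP _ x0 xa; rewrite /f xa; have [[F1 _ _] _] := FP (b x).1.
  move=> bx' _; have [XF YF] := F1 _ bx bx'; split=> //.
  by apply: le_lt_trans YF; exact: (Yle 0%N).
- rewrite le_eqVlt => /predU1P[xE|xa'].
    by rewrite [f x']fa ?xE// fy// -xE.
  have px := bP _ x0 (lt_trans xx' xa').
  have px' := bP _ (lt_trans x0 xx') xa'.
  case: (ltngtP (b x).1 (b x').1) => nm.
  + have [_ fx] := FY _ _ px; have [fx' _] := FY _ _ px'.
    by apply: le_lt_trans fx _; apply: le_lt_trans fx'; exact: Yle.
  + by have := lt_trans xx' (block_lt _ _ _ _ px' px nm); rewrite ltxx.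
  + rewrite (fE _ _ px) (fE _ _ px') nm; have [[_ F2 _] _] := FP (b x').1.
    have [p0 _ xE] := px; have [_ pe' xE'] := px'; apply: F2 => //.
    by move: xx'; rewrite {1}xE {1}xE' nm lt_oadd2l.
- rewrite le_eqVlt => /predU1P[->|xa].
    rewrite fa// => /dcof[N wN].
    (* The last point of block [N.+1] is sent above [Y N.+1], hence above [d N] and [w]. *)
    have pN : block (N.+1, oomega ^ e N.+1) (S N.+2) by split=> //; exact: pow_gt0.
    exists (S N.+2); first exact: block_a pN.
    have [YF _] := FY _ _ pN; have [_ dN _ _] := YS N.
    exact: le_lt_trans (wN _ (leqnn _)) (lt_trans dN YF).
  have px := bP _ (limit_gt0 xl) xa; rewrite (fE _ _ px) => wF.
  have [p0 pe xE] := px; have [[_ _ F3] _] := FP (b x).1.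
  have [||v [v0 vb] wv] := F3 _ w _ pe _ => //.
    by apply: (@limit_oadd (S (b x).1)) => //; rewrite -xE.
  have pv : block ((b x).1, v) (S (b x).1 + v).
    by split=> //=; apply: le_trans (ltW vb) pe.
  exists (S (b x).1 + v); last by rewrite (fE _ _ pv).
  by split; [exact: (block_a _ _ pv).1|rewrite {2}xE lt_oadd2l].
Qed.

(** * The order topology *)

Definition ordpt b x (xb : x < b) : ordspace b := exist (fun y : Ord => y < b) x xb.

(** No point lies strictly between [p] and its successor, so the intervals ending at [p] form a
    neighbourhood base. *)
Lemma nbhs_ordspaceP b (p : ordspace b) (U : set (ordspace b)) :
  nbhs p U <-> U p /\ (0 < sval p -> exists2 z, z < sval p &
    forall q : ordspace b, z < sval q -> sval q < sval p -> U q).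
Proof.
split=> [pU|[Up pz]].
  split=> [|p0]; first exact: nbhs_singleton.
  move: pU; rewrite itv_nbhsE => -[[l r] [lr plr] sub].
  have [z zp zl] : exists2 z, z < sval p & forall q : ordspace b,
      z < sval q -> (q <= p)%O -> q \in Interval l r.
    move: plr; rewrite itv_boundlr => /andP[lp pr].
    have qr (q : ordspace b) : (q <= p)%O -> (BRight q <= r)%O.
      by move=> qp; apply: le_trans pr; rewrite bnd_simp.
    case: l lr lp {sub} => [[] a|[]] lr lp.
    - by have := itv_open_ends_lside lr.
    - exists (sval a) => // q aq qp; rewrite itv_boundlr qr// andbT.
      exact: aq.
    - by exists 0 => // q _ qp; rewrite itv_boundlr qr.
    - by have := itv_open_ends_linfty lr.
  by exists z => // q zq /ltW qp; apply: sub; exact: zl.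
(* This set is the open ray below the successor of [p], or the whole space if [p] is its largest
   point. *)
have low : nbhs p [set q : ordspace b | (q <= p)%O].
  have [pb|bp] := ltP (osucc (sval p)) b.
    have : nbhs p [set` `]-oo, (ordpt pb)[].
      apply: open_nbhs_nbhs; split; first exact: lray_open.
      by rewrite /= in_itv /=; exact: osucc_lt.
    apply: filterS => q /=; rewrite in_itv /=.
    by rewrite [(_ < _)%O]lt_osucc.
  apply: filterS filterT => q _ /=; have := valP q; rewrite /=.
  by move=> /lt_le_trans/(_ bp); rewrite lt_osucc.
have [p0|p0] := eqVneq (sval p) 0.
  apply: filterS low => q qp; have q0 : sval q = 0.
    by apply/eqP; rewrite -leo0 -p0; exact: qp.
  suff -> : q = p by [].
  by apply: val_inj; rewrite /= q0.
rewrite -lt0o in p0; have [z zp zU] := pz p0.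
have zb : z < b by apply: lt_trans zp (valP p).
have up : nbhs p [set` `](ordpt zb), +oo[].
  by apply: open_nbhs_nbhs; split; [exact: rray_open|rewrite /= in_itv /= andbT].
apply: filterS (filterI low up) => q [/= qp]; rewrite in_itv /= andbT => zq.
by move: qp; rewrite le_eqVlt => /predU1P[->//|]; exact: zU.
Qed.

Lemma ordspace_inj b (p q : ordspace b) : sval p = sval q -> p = q.
Proof. exact: val_inj. Qed.

(** In contrast to [rank_ge], this version refers to the topology alone and can be carried along
    homeomorphisms. *)
Inductive top_rank_ge (T : topologicalType) (d : Ord) (x : T) : Prop :=
  TopRankGe of forall e, e < d -> forall U, nbhs x U ->
    exists y, [/\ U y, y <> x & top_rank_ge e y].

Lemma top_rank_ge_inj (S T : topologicalType) (f : S -> T) d x :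
  injective f -> continuous f -> top_rank_ge d x -> top_rank_ge d (f x).
Proof.
move=> finj fcont; elim/lt_ord_ind: d x => d IH x [xd]; split=> e ed U fxU.
have [y [Uy yx ye]] := xd e ed _ (fcont x _ fxU).
by exists (f y); split=> //; [move=> /finj|exact: IH].
Qed.

Lemma rank_ge_ordspace b d (p : ordspace b) : rank_ge setT d (sval p) -> top_rank_ge d p.
Proof.
elim/lt_ord_ind: d p => d IH p [pd]; split=> e ed U /nbhs_ordspaceP[Up Uz].
have [p0 pz] := pd e ed; have [z zp zU] := Uz p0.
have [y [zy yp _ ye]] := pz z zp; have yb : y < b := lt_trans yp (valP p).
exists (ordpt yb); split; [exact: zU| |exact: IH].
by move=> /(congr1 sval) E; move: yp; rewrite /= -E ltxx.
Qed.

(* the exponent of the last term of the Cantor normal form of [x > 0], which is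
   the Cantor-Bendixson rank of [x] *)
Definition rank (x : Ord) : Ord := least [set r | exists u, x = u + oomega ^ r].

Lemma rankP x : 0 < x -> exists u, x = u + oomega ^ rank x.
Proof.
move=> x0; suff : [set r | exists u, x = u + oomega ^ r] !=set0 by move=> /leastP[].
elim/lt_ord_ind: x x0 => x IH x0.
have [h [m [y [_ yh xE]]]] := lt_pow_decomp x0 (le_lt_trans (le_pow x) (pow_ltS x)).
have [y0|] := eqVneq y 0.
  exists h, (oomega ^ h * ord_of_nat m).
  by rewrite xE y0 oadd0 [ord_of_nat _.+1]/= omulS.
rewrite -lt0o => y0; have [|r [u yE]] := IH y _ y0; last first.
  by exists r, (oomega ^ h * ord_of_nat m.+1 + u); rewrite xE yE oaddA.
apply: lt_le_trans yh _; rewrite xE; apply: le_trans (le_oaddr _ _).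
by rewrite -{1}[oomega ^ h]omul1 (@le_omul_nat _ 1).
Qed.

Lemma rank_le x u r : x = u + oomega ^ r -> rank x <= r.
Proof.
move=> xE; have [|_] := @leastP [set r | exists u, x = u + oomega ^ r].
  by exists r, u.
by apply; exists u.
Qed.

(** With [x = u + oomega ^ rank x], a point between [u] and [x] is [u + v] with
    [0 < v < oomega ^ rank x], so its last exponent is smaller. *)
Lemma rank_lt_nbhs x : 0 < x -> exists2 z, z < x & forall y, z < y -> y < x -> rank y < rank x.
Proof.
move=> x0; have [u xE] := rankP x0; exists u; first by rewrite {1}xE lt_oaddr pow_gt0.
move=> y uy; have [v yE] := oadd_sub (ltW uy); rewrite {1}xE yE lt_oadd2l => vx.
have v0 : 0 < v by move: uy; rewrite yE lt_oaddr.
have [w vE] := rankP v0; apply: (@le_lt_trans _ _ (rank v)).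
  by apply: (@rank_le _ (u + w)); rewrite -oaddA -vE.
by rewrite -lt_pow2; apply: le_lt_trans vx; rewrite {2}vE le_oaddl.
Qed.

Lemma rank_lt x g : 0 < x -> x < oomega ^ g -> rank x < g.
Proof.
move=> x0; have [u {1}->] := rankP x0 => xg.
by rewrite -lt_pow2; apply: le_lt_trans xg; exact: le_oaddl.
Qed.

(** Near [p] all other points have smaller rank, hence smaller [f] inside [X]. The second conclusion
    rules out the point 0, where [rank] is a default value. *)
Lemma top_rank_ge_set b (X : set (ordspace b)) (f : Ord -> Ord) :
  (forall p q, X p -> X q -> 0 < sval p -> 0 < sval q -> rank (sval p) < rank (sval q) ->
     f (rank (sval p)) < f (rank (sval q))) ->
  forall d (p : set_type X), top_rank_ge d p ->
    d <= f (rank (sval (set_val p))) /\ (0 < d -> 0 < sval (set_val p)).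
Proof.
move=> fX; elim/lt_ord_ind => d IH p [pd].
pose V q := q = set_val p \/ [/\ 0 < sval (set_val p), 0 < sval q &
  rank (sval q) < rank (sval (set_val p))].
have pV : nbhs (set_val p) V.
  apply/nbhs_ordspaceP; split=> [|p0]; first by left.
  have [z zp zr] := rank_lt_nbhs p0; exists z => // q zq qp; right; split=> //.
    exact: le_lt_trans (ozero_le z) zq.
  exact: zr.
have pd' e : e < d -> e < f (rank (sval (set_val p))) /\ 0 < sval (set_val p).
  move=> ed; have [q [+ qp qe]] := pd e ed _ (@initial_continuous _ _ set_val p _ pV).
  rewrite /= => -[/val_inj//|[p0 q0 qr]]; split=> //.
  have [eq _] := IH e ed q qe; apply: le_lt_trans eq _.
  by apply: fX => //; apply: set_valP.
split=> [|/pd'[]//].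
by rewrite leNgt; apply/negP => /pd'[]; rewrite ltxx.
Qed.

(** By monotonicity, the interval (z, p] is mapped onto the trace of (f z, f p] on the range, so the
    inverse is continuous too. *)
Lemma homeomorphic_range a b (f : ordspace a -> ordspace b) :
  (forall p q, sval p < sval q -> sval (f p) < sval (f q)) -> continuous f ->
  homeomorphic (set_type (range f)) (ordspace a).
Proof.
move=> fmono fcont.
have finj : injective f.
  move=> p q E; apply: ordspace_inj; case: (ltgtP (sval p) (sval q)) => // /fmono.
    by rewrite E ltxx.
  by rewrite E ltxx.
have flt p q : sval (f p) < sval (f q) -> sval p < sval q.
  by apply: contraTT; rewrite -!leNgt le_eqVlt => /predU1P[/ordspace_inj->//|/fmono/ltW].
have mem p : f p \in range f by apply/mem_set; exists p.
pose h (p : ordspace a) : set_type (range f) := exist _ (f p) (mem p).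
have [g gP] : {g : set_type (range f) -> ordspace a | forall x, f (g x) = set_val x}.
  apply/cid; suff /choice[g gP] : forall x : set_type (range f), exists p, f p = set_val x.
    by exists g.
  by move=> x; have [p _ px] := set_valP x; exists p.
have gK : cancel g h by move=> x; apply: val_inj; exact: gP.
have hK : cancel h g by move=> p; apply: finj; rewrite gP.
exists g, h; split=> //.
  move=> x U; rewrite /= => /nbhs_ordspaceP[Up Uz].
  (* Quantifying over preimages makes [V] hold vacuously off the range. *)
  pose V q := forall y, f y = q -> U y.
  have xV : nbhs (set_val x) V.
    rewrite -gP; apply/nbhs_ordspaceP; split=> [y /finj->//|fp0].
    have [p0|] := eqVneq (sval (g x)) 0.
      by exists 0 => // q _ qp y yq; move: qp; rewrite -yq => /flt; rewrite p0 ltNge ozero_le.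
    rewrite -lt0o => /Uz[z zp zU]; have za := lt_trans zp (valP (g x)).
    exists (sval (f (ordpt za))); first exact: fmono.
    by move=> q zq qp y yq; rewrite -yq in zq qp; apply: zU; [exact: (flt (ordpt za))|exact: flt].
  have xV' : nbhs x (set_val @^-1` V) := @initial_continuous _ _ set_val x _ xV.
  by apply: filterS xV' => y yV; exact: yV (gP y).
move=> p U; rewrite /nbhs /= => -[_ [[B Bo <-] Bp sub]].
have : nbhs p (f @^-1` B) by apply: fcont; exact: open_nbhs_nbhs.
by apply: filterS => q qB; apply: (sub (h q)); exact: qB.
Qed.

(** * The partition relation *)

(** The point 0 and successors are isolated, so only limits need a condition. *)
Lemma continuous_ordspace a b (f : ordspace a -> ordspace b) :
  (forall p q, sval p < sval q -> sval (f p) < sval (f q)) ->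
  (forall (p : ordspace a) w, is_limit (sval p) -> w < sval (f p) ->
     exists2 q : ordspace a, sval q < sval p & w < sval (f q)) ->
  continuous f.
Proof.
move=> fmono flim p U /nbhs_ordspaceP[Up Uz].
apply/(nbhs_ordspaceP p (f @^-1` U)); split=> // p0.
case: (ordP (sval p)) => [E|g gE|pl].
- by rewrite E ltxx in p0.
- exists g; first by rewrite gE osucc_lt.
  by move=> q gq; rewrite gE lt_osucc leNgt gq.
- have fp0 : 0 < sval (f p).
    have a0 : 0 < a := lt_trans p0 (valP p).
    exact: le_lt_trans (ozero_le _) (fmono (ordpt a0) p p0).
  have [w wf wU] := Uz fp0; have [q qp wq] := flim p w pl wf.
  exists (sval q) => // r qr rp; apply: wU; last exact: fmono.
  exact: lt_trans (fmono _ _ qr).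
Qed.

(** The shift by 1 on the left takes the space, which starts at 0, into the domain of [f]; it fixes
    [oomega ^ a] because [a] is positive. *)
Lemma normal_into_homeomorphic X a b f : 0 < a ->
  normal_into X 0 (oomega ^ a) f -> f (oomega ^ a) < b ->
  exists2 Y : set (ordspace b), (forall p, Y p -> X (sval p)) &
    homeomorphic (set_type Y) (ordspace (osucc (oomega ^ a))).
Proof.
move=> a0 [f1 f2 f3] fb; set l := oomega ^ a in f1 f2 f3 fb *.
have addl x : x <= l -> 0 < 1 + x /\ 1 + x <= l.
  move=> xl; split; first by apply: lt_le_trans (le_oaddr _ _); exact: osucc_lt.
  rewrite -[l](@add_pow 1 a) ?le_oadd2l//.
  by rewrite -[1](oexp0 oomega) lt_pow2.
have pl (p : ordspace (osucc l)) : sval p <= l by rewrite -lt_osucc; exact: (valP p).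
have fpb (p : ordspace (osucc l)) : f (1 + sval p) < b.
  apply: le_lt_trans fb; have [p0 pl'] := addl _ (pl p).
  by move: pl'; rewrite le_eqVlt => /predU1P[->//|pl1]; exact/ltW/f2.
pose F (p : ordspace (osucc l)) := ordpt (fpb p).
have Fmono p q : sval p < sval q -> sval (F p) < sval (F q).
  move=> pq /=; have [p0 _] := addl _ (pl p); have [_ ql] := addl _ (pl q).
  by apply: f2 => //; rewrite lt_oadd2l.
exists (range F).
  by move=> _ [p _ <-] /=; have [p0 pl'] := addl _ (pl p); have [] := f1 _ p0 pl'.
apply: homeomorphic_range => //; apply: continuous_ordspace => // p w plim /= wf.
have [p0 pl'] := addl _ (pl p).
(* The shift preserves limits, so the limit clause on [f] applies. *)
have plim' : is_limit (1 + sval p).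
  split=> [E|g gE]; first by rewrite E ltxx in p0.
  have /lt_oaddP[|[v vp gv]] : g < 1 + sval p by rewrite -gE osucc_lt.
    rewrite lt_osucc leo0 => /eqP g0; move: gE; rewrite g0 => E.
    have := limit_lt plim (limit_gt0 plim); rewrite -(lt_oadd2l 1) -E.
    by rewrite ltNge le_oaddr.
  have := limit_lt plim vp; rewrite -(lt_oadd2l 1) -gE oaddS lt_osucc2.
  by rewrite ltNge gv.
have [v [v0 vp] wv] := f3 _ w plim' pl' wf.
have [q qE] : exists q, v = 1 + q by apply: oadd_sub; rewrite osucc_le.
have qp : q < sval p by rewrite -(lt_oadd2l 1) -qE.
by exists (ordpt (lt_trans qp (valP p))) => //=; rewrite -qE.
Qed.

Lemma top_arrow_natsum k (alpha : 'I_k -> Ord) : (0 < k)%N ->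
  (forall i, alpha i < oomega1) -> (forall i, 0 < alpha i) ->
  top_arrow (osucc (oomega ^ (\big[natsum/0]_(i < k) alpha i)))
    (fun i => osucc (oomega ^ alpha i)).
Proof.
move=> k0 a1 a0; set g := \big[natsum/0]_(i < k) alpha i => c.
have g1 : oomega ^ g < oomega1.
  by apply/oexp_oomega1/(interleaved_oomega1 (interleaved_big_natsum alpha k0)).
(* [rank_ge] is about sets of ordinals, so [c] is extended to all of them; the colour outside the
   space is arbitrary. *)
pose C (x : Ord) := if pselect (x < osucc (oomega ^ g)) is left xb then c (ordpt xb)
  else Ordinal k0.
have CE p : C (sval p) = c p.
  rewrite /C; case: pselect => [pb|]; last by have := valP p.
  by congr c; exact: ordspace_inj.
have := @rank_ge_pow g 0; rewrite add0o => /(@rank_ge_colour _ C)[y yg yr].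
have y0 : 0 < y by case: yr => /(_ 0 (a0 _))[].
have [f fn fE] := normal_into_pow_exists (a1 _) (le_lt_trans yg g1) erefl yr y0.
have [|Y YC Yh] := @normal_into_homeomorphic _ _ (osucc (oomega ^ g)) _ (a0 _) fn.
  by rewrite fE lt_osucc.
exists (C y), Y; split=> // p /YC /=.
by rewrite /= CE.
Qed.

Lemma top_arrow_natsum_le k (alpha : 'I_k -> Ord) b : (0 < k)%N ->
  (forall i, 0 < alpha i) -> top_arrow b (fun i => osucc (oomega ^ alpha i)) ->
  osucc (oomega ^ (\big[natsum/0]_(i < k) alpha i)) <= b.
Proof.
move=> k0 a0; set g := \big[natsum/0]_(i < k) alpha i => arrow.
rewrite osucc_le ltNge; apply/negP => bg.
have [C [f [fC fS]]] := interleaved_big_natsum alpha k0.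
have [i [X [XC [h [h' [hK h'K hc h'c]]]]]] := arrow (fun p => C (rank (sval p))).
pose t : ordspace (osucc (oomega ^ alpha i)) := ordpt (osucc_lt _).
have tr : top_rank_ge (alpha i) t.
  by apply: rank_ge_ordspace; rewrite -[sval t]add0o; exact: rank_ge_pow.
have rg (p : ordspace b) : 0 < sval p -> rank (sval p) < g.
  move=> p0; apply: rank_lt => //; exact: lt_le_trans (valP p) bg.
have fX p q : X p -> X q -> 0 < sval p -> 0 < sval q ->
    rank (sval p) < rank (sval q) -> f (rank (sval p)) < f (rank (sval q)).
  by move=> Xp Xq _ q0 pq; apply: fS => //; [exact: rg|rewrite (XC _ Xp) (XC _ Xq)].
(* The image of the top point has rank at least [alpha i] in [X], hence so has its position [f],
   which should be below [alpha i]. *)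
have [le /(_ (a0 i)) pt0] := top_rank_ge_set fX (top_rank_ge_inj (can_inj h'K) h'c tr).
have := fC _ (rg _ pt0); have /XC /= -> := set_valP (h' t).
by rewrite ltNge le.
Qed.

Theorem theorem4p5 (k : nat) (alpha : 'I_k -> Ord) (k_gt0 : (0 < k)%N)
    (alpha_lt : forall i, alpha i < oomega1)
    (alpha_neq0 : forall i, alpha i <> 0) :
  Ptop (fun i => oomega ^ alpha i + 1)
  = oomega ^ (\big[natsum/0]_(i < k) alpha i) + 1.
Proof.
have a0 i : 0 < alpha i by rewrite lt0o; apply/eqP.
rewrite oadd1 (_ : (fun i => _) = fun i => osucc (oomega ^ alpha i)); last first.
  by apply/funext => i; rewrite oadd1.
have arrow := top_arrow_natsum k_gt0 alpha_lt a0.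
(* [least] is a true minimum only on a nonempty set; [arrow] supplies an element. *)
have [|Parrow Pmin] := @leastP [set b | top_arrow b (fun i => osucc (oomega ^ alpha i))].
  by exists (osucc (oomega ^ (\big[natsum/0]_(i < k) alpha i))).
apply: le_anti; rewrite (Pmin _ arrow)/=.
exact: top_arrow_natsum_le.
Qed.
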